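(* Let $p$ be an odd prime, let $A, B$ be integers, and let $\Delta = A^2 + 4B$. If $\Delta$ is a quadratic nonresidue modulo $p$, then $k_{A,B}(p)$ divides $2(p+1)\cdot \mathrm{ord}(B^2)$, where $\mathrm{ord}(n)$ denotes the multiplicative order of $n$ modulo $p$. In particular, $$k_{A,B}(p) \le 2(p+1)\cdot \mathrm{ord}(B^2).$$
   Context: For integers $A, B$, let $(E_n)_{n \ge 0}$ be the sequence defined by $E_0 = 0$, $E_1 = 1$ and $E_{n+1} = A E_n + B E_{n-1}$ for $n \ge 1$. For a prime $p$, $k_{A,B}(p)$ denotes the period of the sequence $(E_n)$ reduced modulo $p$, i.e. the smallest positive index $i$ such that $E_i \equiv 0$ and $E_{i+1} \equiv 1 \pmod p$ (this exists whenever $p \nmid B$, which is automatic when $\Delta$ is a quadratic nonresidue modulo $p$). The multiplicative order $\mathrm{ord}(n)$ of an integer $n$ coprime to $p$ is the smallest positive integer $t$ such that $n^t \equiv 1 \pmod p$. *)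

(* Defs.v *)
From mathcomp Require Import all_boot all_order all_algebra.

Set Implicit Arguments.
Unset Strict Implicit.
Unset Printing Implicit Defensive.

Import GRing.Theory.
Local Open Scope ring_scope.

Fixpoint Eseq (A B : int) (n : nat) {struct n} : int :=
  match n with
  | 0%N => 0
  | n1.+1 => match n1 with
             | 0%N => 1
             | n2.+1 => A * Eseq A B n1 + B * Eseq A B n2
             end
  end.

Lemma EseqSS A B n : Eseq A B n.+2 = A * Eseq A B n.+1 + B * Eseq A B n.
Proof. by []. Qed.

Definition smallest_pos (P : nat -> Prop) (k : nat) : Prop :=
  [/\ (0 < k)%N, P k & forall j : nat, (0 < j)%N -> P j -> (k <= j)%N].

Lemma smallest_pos_uniq P k l : smallest_pos P k -> smallest_pos P l -> k = l.
Proof.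
move=> [k0 Pk mink] [l0 Pl minl].
by apply/eqP; rewrite eqn_leq mink // minl.
Qed.

(* The period and the multiplicative order are rendered as relations, since
   they are defined only when a suitable index exists; smallest_pos_uniq shows
   that each relation determines its value. *)
Definition is_period (A B : int) (p k : nat) : Prop :=
  smallest_pos (fun i => (Eseq A B i = 0 %[mod p])%Z /\
                         (Eseq A B i.+1 = 1 %[mod p])%Z) k.

Definition is_mult_order (p : nat) (n : int) (t : nat) : Prop :=
  smallest_pos (fun s => (n ^+ s = 1 %[mod p])%Z) t.

Definition quadratic_nonresidue (p : nat) (d : int) : Prop :=
  coprimez d p /\ ~ (exists x : int, (x ^+ 2 = d %[mod p])%Z).

(* Main.v *)
(* Over F_p let M be the companion matrix of X^2 - A X - B, so that
   E_i = 0 and E_(i+1) = 1 mod p exactly when M^i = 1: the period is the order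
   of M.  The matrix S = 2 M - A squares to Delta, hence S^p = - S by Euler's
   criterion, and the Frobenius identity (A + S)^p = A^p + S^p gives
   M^p = A - M, that is M^(p+1) = - B.  Therefore M^(2 (p+1)) = B^2. *)
Require Import Defs.
From mathcomp Require Import all_boot all_order all_algebra.
From mathcomp Require Import cyclic finfield ring.

Set Implicit Arguments.
Unset Strict Implicit.

Import GRing.Theory.
Local Open Scope ring_scope.

Lemma eqz_mod_pchar (R : nzRingType) (p : nat) (m n : int) :
  p \in [pchar R] -> (m = n %[mod p])%Z <-> m%:~R = n%:~R :> R.
Proof.
move=> charRp; split=> [/eqP | eq_mn].
  by rewrite eqz_mod_dvd (dvdz_pcharf charRp) intrB subr_eq0 => /eqP.
by apply/eqP; rewrite eqz_mod_dvd (dvdz_pcharf charRp) intrB subr_eq0 eq_mn eqxx.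
Qed.

(** Primitive roots make sense in noncommutative rings too, so this serves both for the order of
    [B ^+ 2] in ['F_p] and for that of the matrix. *)
Lemma prim_root_smallest_pos (R : nzRingType) (z : R) (n : nat) :
  n.-primitive_root z -> smallest_pos (fun i => z ^+ i = 1) n.
Proof.
move=> prim_z; split; [exact: prim_order_gt0 prim_z | exact: prim_expr_order |].
move=> j j_gt0 zj1; apply: dvdn_leq => //.
by rewrite (prim_order_dvd prim_z) zj1.
Qed.

Lemma smallest_pos_iff (P Q : nat -> Prop) (n : nat) :
  (forall i, P i <-> Q i) -> smallest_pos P n -> smallest_pos Q n.
Proof.
move=> PQ [n_gt0 /PQ Qn min_n]; split=> // j j_gt0 /PQ; exact: min_n.
Qed.

(** The power is a square root of 1, so only the value 1 has to be excluded. Write [d] as a power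
    [z ^+ i] of a generator of the unit group, whose order is [h.*2]: if [d ^+ h = 1], then [2 * h]
    divides [i * h], so [i] is even and [d] is a square. *)
Lemma nonsquare_expf_half (F : finFieldType) (d : F) :
  odd #|F| -> (forall x, x ^+ 2 != d) -> d ^+ #|F|./2 = -1.
Proof.
move=> oddF nsq_d; set h := #|F|./2.
have cardF : #|F| = h.*2.+1 by rewrite -[LHS]odd_double_half oddF.
have h_gt0 : (0 < h.*2)%N by rewrite -ltnS -cardF finNzRing_gt1.
have expf1 (x : F) : x != 0 -> x ^+ h.*2 = 1.
  move=> x_neq0; apply: (mulfI x_neq0).
  by rewrite -exprS -cardF expf_card mulr1.
have d_neq0 : d != 0.
  by apply: contraNneq (nsq_d 0) => ->; rewrite expr0n.
have [z prim_z] : exists z : F, h.*2.-primitive_root z.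
  suff /hasP[z _ prim_z] : has h.*2.-primitive_root (enum (predC1 (0 : F))).
    by exists z.
  apply: has_prim_root; rewrite ?enum_uniq //.
    by apply/allP=> x; rewrite mem_enum unity_rootE => /expf1 ->.
  by rewrite -cardE cardC1 cardF.
have /eqP := expf1 _ d_neq0.
rewrite -muln2 exprM sqrf_eq1 => /orP[|/eqP //].
have [i def_d] := prim_rootP prim_z (expf1 _ d_neq0).
rewrite def_d -exprM -(prim_order_dvd prim_z) -[X in (X %| _)%N]mul2n dvdn_pmul2r -1?double_gt0 //.
case/dvdnP=> j def_i; case/negP: (nsq_d (z ^+ j)).
by rewrite def_d def_i exprM.
Qed.

Lemma expFp_prime (p : nat) (c : 'F_p) : prime p -> c ^+ p = c.
Proof. by move=> p_prime; have := expf_card c; rewrite card_Fp. Qed.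

Section QuadraticFrobenius.

Variables (p : nat) (R : algType 'F_p) (x : R) (a b : 'F_p).
Hypotheses (p_prime : prime p) (p_odd : odd p).
Hypothesis nsq_discr : forall y : 'F_p, y ^+ 2 != a ^+ 2 + 4 * b.
Hypothesis sqr_x : x ^+ 2 = a *: x + b%:A.

Let two_neq0 : (2 : 'F_p) != 0.
Proof.
rewrite -(dvdn_pcharf (pchar_Fp p_prime)) (dvdn_prime2 p_prime) //.
by apply: contraTneq p_odd => ->.
Qed.

(** The ambient algebra need not be commutative, so that [x] can be a matrix. *)
Lemma Frobenius_quadratic_root : x ^+ p = a%:A - x.
Proof.
pose s := 2 *: x - a%:A.
have sqr_s : s ^+ 2 = (a ^+ 2 + 4 * b)%:A.
  rewrite expr2 /s mulrBl !mulrBr -!scalerAl -!scalerAr !mul1r mulr1 -expr2.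
  rewrite sqr_x !scalerDr !scalerA.
  rewrite [X in X - _]addrAC opprB [_%:A - _]addrC addrACA -!scalerBl -!scalerDl.
  rewrite (_ : 2 * 2 * a - 2 * a - a * 2 = 0); last by ring.
  by rewrite scale0r add0r; congr (_ *: _); ring.
have exp_s : s ^+ p = - s.
  have -> : s ^+ p = s ^+ (p./2).*2.+1.
    by congr (s ^+ _); rewrite -[LHS]odd_double_half p_odd.
  rewrite exprS -mul2n exprM sqr_s.
  have := nonsquare_expf_half _ nsq_discr.
  rewrite card_Fp // exprZn expr1n => -> //.
  by rewrite scaleN1r mulrN1.
have charRp : p \in [pchar R] by rewrite pchar_lalg pchar_Fp.
have def_2x : 2 *: x = a%:A + s by rewrite addrC subrK.
have : (2 *: x) ^+ p = 2 *: (a%:A - x).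
  (* Frobenius is additive on commuting elements, and the scalar [a%:A] commutes with [s]. *)
  rewrite def_2x -(pFrobenius_autE charRp) pFrobenius_autD_comm; last first.
    by rewrite /GRing.comm -scalerAl -scalerAr mul1r mulr1.
  rewrite !pFrobenius_autE exp_s exprZn expr1n expFp_prime // /s.
  by rewrite scalerBr opprB addrA [2 *: a%:A]scaler_nat mulr2n.
(* Since [2 ^+ p = 2] in ['F_p], the factor 2 cancels. *)
by rewrite exprZn expFp_prime // => /(scalerI two_neq0).
Qed.

Lemma norm_quadratic_root : x ^+ p.+1 = (- b)%:A.
Proof.
rewrite exprS Frobenius_quadratic_root mulrBr -scalerAr mulr1 -expr2 sqr_x.
by rewrite opprD addrA subrr add0r scaleNr.
Qed.

End QuadraticFrobenius.

Section CompanionMatrix.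

Variables (R : comNzRingType) (a b : R).

(** With rows (a, b) and (1, 0), it sends the column (E_(n+1), E_n) to (E_(n+2), E_(n+1)). *)
Definition companion2 : 'M[R]_2 :=
  \matrix_(i, j) if i == 0 then (if j == 0 then a else b) else (j == 0)%:R.

Lemma sqr_companion2 : companion2 ^+ 2 = a *: companion2 + b%:A.
Proof.
apply/matrixP=> i j; rewrite expr2 !mxE !big_ord_recr big_ord0 /= !mxE /=.
case: i => [[|[|//]] ?]; case: j => [[|[|//]] ?] /=;
  rewrite !(mulr0, mulr1, mul0r, mul1r, add0r, addr0) //.
Qed.

End CompanionMatrix.

(** Induction, reducing [M ^+ 2] at each step. The exponent starts at 1 because the constant
    coefficient involves the preceding term of the sequence. *)
Lemma expr_companion2S (R : comNzRingType) (A B : int) (n : nat) :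
  companion2 A%:~R B%:~R ^+ n.+1 =
    (Eseq A B n.+1)%:~R *: companion2 A%:~R B%:~R
    + (B * Eseq A B n)%:~R%:A :> 'M[R]_2.
Proof.
elim: n => [|n IHn]; first by rewrite mulr0 scale0r addr0 scale1r expr1.
rewrite exprSr IHn mulrDl -!scalerAl -expr2 sqr_companion2 mul1r.
rewrite scalerDr !scalerA addrAC -scalerDl EseqSS.
by rewrite -!intrM -intrD [Eseq _ _ _ * A]mulrC [Eseq _ _ _ * B]mulrC.
Qed.

Lemma expr_companion2_eq1 (R : comNzRingType) (A B : int) (n : nat) :
  companion2 A%:~R B%:~R ^+ n = 1 :> 'M[R]_2 <->
  (Eseq A B n)%:~R = 0 :> R /\ (Eseq A B n.+1)%:~R = 1 :> R.
Proof.
case: n => [|n]; first by rewrite expr0.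
rewrite expr_companion2S EseqSS; split=> [/matrixP eqM | [En0]].
  (* The lower left entry isolates E_(n+1); once it vanishes, the upper left entry is B E_n, which
     is then E_(n+2). *)
  have:= eqM 1 0; rewrite !mxE /= mulr1 mulr0 addr0 => En0.
  have:= eqM 0 0; rewrite !mxE /= En0 mul0r add0r mulr1 => En1.
  by rewrite intrD intrM En0 mulr0 add0r.
by rewrite intrD intrM En0 mulr0 add0r scale0r add0r => ->; rewrite scale1r.
Qed.

Theorem theorem9 (p : nat) (p_prime : prime p) (p_odd : odd p) (A B : int)
    (Delta_nonres : quadratic_nonresidue p (A ^+ 2 + 4 * B)) :
  exists k t : nat,
    [/\ is_period A B p k,
        is_mult_order p (B ^+ 2) t,
        (k %| 2 * (p + 1) * t)%N
      & (k <= 2 * (p + 1) * t)%N].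
Proof.
have charFp := pchar_Fp p_prime.
pose a : 'F_p := A%:~R; pose b : 'F_p := B%:~R.
have nsq_discr (y : 'F_p) : y ^+ 2 != a ^+ 2 + 4 * b.
  apply/eqP=> def_d; case: Delta_nonres => _; case; exists (y : nat)%:Z.
  apply/(eqz_mod_pchar _ _ charFp).
  by rewrite rmorphXn /= -pmulrn natr_Zp def_d rmorphD rmorphM rmorphXn.
have b_neq0 : b != 0.
  (* If [b] were 0, the discriminant would be the square of [a]. *)
  by apply: contraNneq (nsq_discr a) => ->; rewrite mulr0 addr0.
pose M := companion2 a b.
have expM : M ^+ (2 * (p + 1)) = (b ^+ 2)%:A.
  rewrite mulnC exprM addn1.
  rewrite (norm_quadratic_root p_prime p_odd nsq_discr (sqr_companion2 a b)).
  by rewrite exprZn expr1n sqrrN.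
have expb : (b ^+ 2) ^+ p.-1 = 1.
  rewrite exprAC; suff ->: b ^+ p.-1 = 1 by rewrite expr1n.
  apply: (mulfI b_neq0); rewrite -exprS prednK ?prime_gt0 // mulr1.
  exact: expFp_prime.
have p1_gt0 : (0 < p.-1)%N by rewrite -subn1 subn_gt0 prime_gt1.
have [t prim_b _] := prim_order_exists p1_gt0 expb.
have t_gt0 := prim_order_gt0 prim_b.
have expMt : M ^+ (2 * (p + 1) * t) = 1.
  by rewrite exprM expM exprZn expr1n (prim_expr_order prim_b) scale1r.
have n_gt0 : (0 < 2 * (p + 1) * t)%N by rewrite !muln_gt0 addn1.
(* The exact order of [M] divides any positive exponent that kills it, which is the claimed
   divisibility. *)
have [k prim_M k_dvd] := prim_order_exists n_gt0 expMt.
exists k, t; split=> //; last exact: dvdn_leq.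
  apply: smallest_pos_iff (prim_root_smallest_pos prim_M) => i.
  by rewrite expr_companion2_eq1 !(eqz_mod_pchar _ _ charFp).
apply: smallest_pos_iff (prim_root_smallest_pos prim_b) => i.
by rewrite (eqz_mod_pchar _ _ charFp) !rmorphXn.
Qed.
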